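(* Let $(m_1,m_2,m_3,q,p):[0,t^* )\to\mathbb{R}^3\times(0,\pi)\times\mathbb{R}$ be a collision trajectory of the reduced two-body system, with initial datum $D$, and let $C=m_1^2+m_2^2+m_3^2$ be the (constant) value of the Casimir function along it. Then the projection $t\mapsto (m_1(t),m_2(t),m_3(t))$ of the solution onto the sphere $\{m_1^2+m_2^2+m_3^2=C\}$ has finite length, i.e. $\int_0^{t^*}\sqrt{\dot m_1^2+\dot m_2^2+\dot m_3^2}\,dt<+\infty$. Consequently the omega-limit set $\Omega(D)$ is a singleton of the form $\{m_1=m_1^*,\ m_2=m_2^*,\ m_3=0,\ q=0,\ p=-\infty\}$ for some real numbers $m_1^*,m_2^*$.
   Context: The reduced two-body system on $S^2$ (two identical bodies of mass $1$, potential $V(q)=-\cot q$, where $q\in(0,\pi)$ is the angle between the position vectors) is the following system of ODEs for $(m_1,m_2,m_3,q,p)\in\mathbb{R}^3\times(0,\pi)\times\mathbb{R}$: $$\dot m_1=\cot(q)\,(-m_2^2+m_3^2+2m_2m_3\cot q),\quad \dot m_2=m_1m_2\cot q-m_3(-2m_1+p+2m_1\csc^2 q),\quad \dot m_3=m_2p-m_1m_3\cot q,$$ $$\dot q=2p-m_1,\qquad \dot p=-\csc^2(q)\,(1+m_2m_3-2m_3^2\cot q).$$ It has the conserved quantities $\mathcal{C}=m_1^2+m_2^2+m_3^2$ (the Casimir function) and, with $\xi=\cot q$, $\mathcal{H}=\frac12\left(m_1^2+m_2^2-2m_1p+2p^2+\xi(-2-2m_2m_3+m_3^2\xi)+m_3^2(1+\xi^2)\right)$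 (the Hamiltonian). A collision trajectory is a solution defined on $[0,t^* )$, $t^*\in(0,+\infty]$, with $q(t)\to0$ as $t\to t^*$; $t^*$ is called the collision time. The omega-limit set $\Omega(D)$ of the solution with initial datum $D$ is the set of all limits of $(m_1,m_2,m_3,q,p)(t_k)$, taken in $\mathbb{R}^4\times[-\infty,+\infty]$ (so that $p=\pm\infty$ is allowed), along sequences $t_k\nearrow t^*$. *)

(* Defs.v *)
From Stdlib Require Import Reals.
From Coquelicot Require Import Coquelicot.
Open Scope R_scope.

Definition cot (x : R) : R := cos x / sin x.
Definition csc (x : R) : R := 1 / sin x.

Definition dom (tstar : Rbar) (t : R) : Prop := 0 <= t /\ Rbar_lt t tstar.

(* The filter [t -> tstar] with [t] in [0, tstar), for finite or infinite [tstar]. *)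
Definition before (tstar : Rbar) : (R -> Prop) -> Prop :=
  within (dom tstar) (Rbar_locally tstar).

(* [D_in f d D t] is differentiability relative to [D], so at [t = 0] the
   derivative is the right one; values outside [0, tstar) are irrelevant. *)
Definition reduced_solution (tstar : Rbar) (m1 m2 m3 q p : R -> R) : Prop :=
  forall t : R, dom tstar t ->
    0 < q t < PI /\
    D_in m1
      (fun s => cot (q s) *
         (- m2 s ^ 2 + m3 s ^ 2 + 2 * m2 s * m3 s * cot (q s)))
      (dom tstar) t /\
    D_in m2
      (fun s => m1 s * m2 s * cot (q s)
         - m3 s * (- 2 * m1 s + p s + 2 * m1 s * csc (q s) ^ 2))
      (dom tstar) t /\
    D_in m3 (fun s => m2 s * p s - m1 s * m3 s * cot (q s)) (dom tstar) t /\
    D_in q (fun s => 2 * p s - m1 s) (dom tstar) t /\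
    D_in p
      (fun s => - csc (q s) ^ 2 *
         (1 + m2 s * m3 s - 2 * m3 s ^ 2 * cot (q s)))
      (dom tstar) t.

Definition collision_trajectory (tstar : Rbar) (m1 m2 m3 q p : R -> R) : Prop :=
  Rbar_lt 0 tstar /\
  reduced_solution tstar m1 m2 m3 q p /\
  filterlim q (before tstar) (locally 0).

Definition casimir (x1 x2 x3 : R) : R := x1 ^ 2 + x2 ^ 2 + x3 ^ 2.

(* [Derive] is two-sided, hence unspecified at [t = 0]; one point does not
   affect the integral. *)
Definition speed (m1 m2 m3 : R -> R) (t : R) : R :=
  sqrt (Derive m1 t ^ 2 + Derive m2 t ^ 2 + Derive m3 t ^ 2).

Definition finite_length (tstar : Rbar) (m1 m2 m3 : R -> R) : Prop :=
  ex_RInt_gen (speed m1 m2 m3) (at_point 0) (before tstar).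

Definition omega_limit (tstar : Rbar) (m1 m2 m3 q p : R -> R)
    (x : R * R * R * R * Rbar) : Prop :=
  let '(x1, x2, x3, xq, xp) := x in
  exists tk : nat -> R,
    (forall k : nat, dom tstar (tk k)) /\
    (forall k : nat, tk k <= tk (S k)) /\
    is_lim_seq tk tstar /\
    is_lim_seq (fun k => m1 (tk k)) (Finite x1) /\
    is_lim_seq (fun k => m2 (tk k)) (Finite x2) /\
    is_lim_seq (fun k => m3 (tk k)) (Finite x3) /\
    is_lim_seq (fun k => q (tk k)) (Finite xq) /\
    is_lim_seq (fun k => p (tk k)) xp.

(* Main.v *)
Require Import Defs.
From Stdlib Require Import Reals.
From Coquelicot Require Import Coquelicot.
From Stdlib Require Import Lra Classical.
Open Scope R_scope.

(** Write [X = cot q], [w = p - m1 / 2] and [v = m3 X - m2 / 2].  Conservation of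
    the Hamiltonian and of the Casimir function reads [w^2 + v^2 = X + O(1)], and
    in these variables the system is a perturbed Kepler problem: [q' = 2 w] is the
    radial velocity and [v / X = m3 - m2 / (2 X)] plays the role of the angular
    momentum.  The equations become
    - [X' = - 2 w (1 + X^2)],
    - [w' = - 1 - X^2 + 2 X v^2 + 2 m3 v - X m3^2 / 2],
    - [v' = - 2 w X v - (3/2) w m3 + m1 m3 / 4],
    - [m1' = X m3^2 + 2 m2 X v], [m2' = - 2 m1 X v - m3 p], [m3' = m2 w - m1 v].

    A collision means [X -> +oo].  If at some late time [4 w^2 <= X], then the
    energy relation forces [v^2 >= 3 X / 4 - O(1)], so that the
    centrifugal term gives [w' >= X^2 / 4] ([slow_infall_decelerates]).  Hence [w]
    can cross [0] only upwards, and once [w >= 0] the function [X] no longer grows: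
    therefore [w < 0] ([infall_negative]).  Then [4 w^2 <= X] would persist and
    make [X + 8 w^2] nonincreasing, which contradicts [X -> +oo]; therefore
    [4 w^2 > X] ([infall_fast]).

    The derivative of the angular momentum satisfies [(v / X)' = O(|w| / X)], which
    is dominated by the derivative of [- 1 / X^2].  As [v / X -> 0], integration up
    to the collision gives [v / X = O(1 / X^2)], that is [X v = O(1)]
    ([angular_momentum_bound]).  With this bound every [mi'] is [O(|w|)], and [|w|]
    is at most minus the derivative of [1 / X]; as [1 / X] is bounded, the length is
    finite and [m1], [m2] converge.  Finally [m3 X = v + m2 / 2] is bounded, so
    [m3 -> 0], and [w < - sqrt X / 2] gives [p -> -oo]. *)

(** * Real functions on an end of the time interval *)

(** The end [T, tstar) of the time interval. *)
Definition tail (T : R) (tstar : Rbar) (t : R) : Prop :=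
  T <= t /\ Rbar_lt t tstar.

Lemma tail_between : forall T tstar a b t,
  tail T tstar a -> tail T tstar b -> a <= t <= b -> tail T tstar t.
Proof.
  intros T tstar a b t [Ha _] [_ Hb] [H1 H2]; split; [lra|].
  apply Rbar_le_lt_trans with (Finite b); [exact H2 | exact Hb].
Qed.

Lemma tail_weaken : forall T T' tstar t, T <= T' -> tail T' tstar t -> tail T tstar t.
Proof. intros T T' tstar t H [H1 H2]; split; [lra | exact H2]. Qed.

Lemma ball_R : forall (c : R) (eps : posreal) (t : R),
  ball c eps t <-> c - eps < t < c + eps.
Proof.
  intros c eps t; unfold ball; simpl; unfold AbsRing_ball, abs, minus, plus, opp; simpl.
  split; intros H; [apply Rabs_def2 in H; lra | apply Rabs_def1; lra].
Qed.

(** A property holds as [t -> tstar] if and only if it holds on some end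
    [T, tstar) with [T > 0]. *)
Lemma before_tail : forall tstar (P : R -> Prop), Rbar_lt 0 tstar ->
  (before tstar P <->
   exists T, 0 < T /\ Rbar_lt T tstar /\ forall t, tail T tstar t -> P t).
Proof.
  intros tstar P Hpos; unfold before, within; split.
  - destruct tstar as [r| |]; simpl in *.
    + intros [eps Heps].
      exists (Rmax (r / 2) (r - eps / 2)); pose proof (cond_pos eps).
      pose proof (Rmax_l (r / 2) (r - eps / 2)).
      pose proof (Rmax_r (r / 2) (r - eps / 2)).
      split; [lra|]; split; [apply Rmax_lub_lt; lra|].
      intros t [Ht1 Ht2]; simpl in Ht2; apply Heps.
      * apply ball_R; lra.
      * split; simpl; lra.
    + intros [M HM]; exists (Rmax (M + 1) 1).
      pose proof (Rmax_l (M + 1) 1); pose proof (Rmax_r (M + 1) 1).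
      split; [lra|]; split; [exact I|].
      intros t [Ht _]; apply HM; [lra|]; split; simpl; [lra | exact I].
    + contradiction.
  - intros (T & HT & HTs & H); destruct tstar as [r| |]; simpl in *.
    + assert (Hd : 0 < r - T) by lra.
      exists (mkposreal _ Hd); intros t Ht [_ Hr].
      apply H; split; [| exact Hr].
      apply ball_R in Ht; simpl in Ht; lra.
    + exists T; intros t Ht _; apply H; split; [lra | exact I].
    + contradiction.
Qed.

Lemma nonincreasing_of_derive : forall T tstar (f df : R -> R),
  (forall t, tail T tstar t -> is_derive f t (df t)) ->
  (forall t, tail T tstar t -> df t <= 0) ->
  forall a b, tail T tstar a -> tail T tstar b -> a <= b -> f b <= f a.
Proof.
  intros T tstar f df Hf Hdf a b Ha Hb Hab.
  destruct (MVT_gen f a b df) as (c & Hc & E).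
  - intros t; rewrite Rmin_left, Rmax_right by lra; intros Ht.
    apply Hf, (tail_between T tstar a b); auto; lra.
  - intros t; rewrite Rmin_left, Rmax_right by lra; intros Ht.
    apply continuity_pt_filterlim, (ex_derive_continuous f).
    exists (df t); apply Hf, (tail_between T tstar a b); auto; lra.
  - rewrite Rmin_left, Rmax_right in Hc by lra.
    assert (df c <= 0) by (apply Hdf, (tail_between T tstar a b); auto; lra).
    nra.
Qed.

(** If [f' < 0] at every zero of [f], then [f <= 0] is preserved in time. *)
Lemma barrier : forall T tstar (f df : R -> R),
  (forall t, tail T tstar t -> is_derive f t (df t)) ->
  (forall t, tail T tstar t -> f t = 0 -> df t < 0) ->
  forall a b, tail T tstar a -> tail T tstar b -> a <= b -> f a <= 0 -> f b <= 0.
Proof.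
  intros T tstar f df Hf Hdf a b Ha Hb Hab Hfa.
  destruct (Rle_lt_dec (f b) 0) as [|Hfb]; [assumption|exfalso].
  (* [c] is the last time before [b] at which [f <= 0]; there [f] vanishes and is
     strictly decreasing, although it is positive immediately after. *)
  destruct (completeness (fun t => a <= t <= b /\ f t <= 0)) as [c [Hub Hlub]].
  { exists b; intros t [[_ H] _]; exact H. }
  { exists a; split; [lra | exact Hfa]. }
  assert (Hac : a <= c) by (apply Hub; split; [lra | exact Hfa]).
  assert (Hcb : c <= b) by (apply Hlub; intros t [[_ H] _]; exact H).
  assert (Hc : tail T tstar c) by (apply (tail_between T tstar a b); auto).
  assert (Hright : forall t, c < t <= b -> 0 < f t).
  { intros t Ht; apply Rnot_le_lt; intros Hle.
    assert (t <= c) by (apply Hub; split; [lra | exact Hle]); lra. }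
  assert (Hcont : continuous f c)
    by (apply (ex_derive_continuous f); exists (df c); auto).
  assert (Hfc : f c = 0).
  { destruct (Rtotal_order (f c) 0) as [Hlt | [E | Hgt]]; [| exact E |]; exfalso.
    - assert (Hn : locally c (fun t => f t < 0)).
      { apply (Hcont (fun y => y < 0)); apply (open_lt 0); exact Hlt. }
      destruct Hn as [eps Heps]; pose proof (cond_pos eps).
      assert (Hcb' : c < b) by (destruct Hcb as [|E]; [assumption | subst; lra]).
      pose (t := Rmin b (c + eps / 2)).
      assert (Ht : c < t <= b /\ t <= c + eps / 2).
      { unfold t; split; [split; [apply Rmin_glb_lt; lra | apply Rmin_l] | apply Rmin_r]. }
      assert (f t < 0).
      { apply Heps; apply ball_R; lra. }
      pose proof (Hright t ltac:(lra)); lra.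
    - assert (Hn : locally c (fun t => 0 < f t)).
      { apply (Hcont (fun y => 0 < y)); apply (open_gt 0); exact Hgt. }
      destruct Hn as [eps Heps]; pose proof (cond_pos eps).
      assert (c <= c - eps / 2); [|lra].
      apply Hlub; intros t [Ht Hle]; apply Rnot_lt_le; intros Hlt.
      assert (t <= c) by (apply Hub; split; assumption).
      assert (0 < f t); [|lra].
      apply Heps; apply ball_R; lra. }
  assert (Hcb' : c < b) by (destruct Hcb as [|E]; [assumption | subst; lra]).
  pose proof (Hdf c Hc Hfc) as Hneg.
  pose proof (proj1 (is_derive_Reals _ _ _) (Hf c Hc)) as Hd.
  destruct (Hd (- df c) ltac:(lra)) as [eps Heps]; pose proof (cond_pos eps).
  pose (h := Rmin (b - c) (eps / 2)).
  assert (Hh : 0 < h <= b - c /\ h <= eps / 2).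
  { unfold h; split; [split; [apply Rmin_glb_lt; lra | apply Rmin_l] | apply Rmin_r]. }
  specialize (Heps h ltac:(lra) ltac:(rewrite Rabs_pos_eq; lra)).
  rewrite Hfc in Heps; apply Rabs_def2 in Heps.
  pose proof (Hright (c + h) ltac:(lra)).
  assert (0 < (f (c + h) - 0) / h) by (apply Rdiv_lt_0_compat; lra).
  lra.
Qed.

Lemma nonincreasing_converges : forall T tstar (f : R -> R) B,
  0 < T -> Rbar_lt T tstar ->
  (forall a b, tail T tstar a -> tail T tstar b -> a <= b -> f b <= f a) ->
  (forall t, tail T tstar t -> B <= f t) ->
  exists l, filterlim f (before tstar) (locally l).
Proof.
  intros T tstar f B HT HTs Hf HB.
  assert (HTT : tail T tstar T) by (split; [lra | exact HTs]).
  assert (Hpos : Rbar_lt 0 tstar)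
    by (apply Rbar_lt_trans with (Finite T); [exact HT | exact HTs]).
  destruct (completeness (fun x => exists t, tail T tstar t /\ x = - f t)) as [l [Hub Hlub]].
  { exists (- B); intros x (t & Ht & ->); pose proof (HB t Ht); lra. }
  { exists (- f T), T; split; [exact HTT | reflexivity]. }
  exists (- l); apply filterlim_locally; intros eps; pose proof (cond_pos eps).
  assert (Hex : exists t0, tail T tstar t0 /\ f t0 < - l + eps).
  { apply NNPP; intros Hn.
    assert (l <= l - eps); [|lra].
    apply Hlub; intros x (t & Ht & ->); apply Rnot_lt_le; intros Hlt.
    apply Hn; exists t; split; [exact Ht | lra]. }
  destruct Hex as (t0 & Ht0 & Hlt).
  apply before_tail; [exact Hpos|].
  exists t0; split; [destruct Ht0; lra|]; split; [apply Ht0|].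
  intros t Ht; destruct (Ht) as [Ht1 Ht2].
  assert (Ht' : tail T tstar t) by (apply tail_weaken with t0; [apply Ht0 | exact Ht]).
  pose proof (Hf t0 t Ht0 Ht' Ht1).
  assert (- f t <= l) by (apply Hub; exists t; auto).
  apply ball_R; lra.
Qed.

(** * The system near a collision *)

(** The functions [m1], [m2], [m3], [X], [w], [v] solve the equations in the
    variables [X = cot q], [w = p - m1 / 2], [v = m3 X - m2 / 2] on [T, tstar);
    [A] bounds the momenta, [B] bounds the error in the energy relation
    [w^2 + v^2 = X + O(1)], and [X] is large and unbounded near [tstar].
    The lower bound on [X] in [nc_large] is what the inequality
    [slow_infall_decelerates] needs. *)
Record near_collision (T : R) (tstar : Rbar) (A B : R)
    (m1 m2 m3 X w v : R -> R) : Prop := {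
  nc_pos : 0 < T;
  nc_lt : Rbar_lt T tstar;
  nc_A : 1 <= A;
  nc_B : 1 <= B;
  nc_m1 : forall t, tail T tstar t -> - A <= m1 t <= A;
  nc_m2 : forall t, tail T tstar t -> - A <= m2 t <= A;
  nc_m3 : forall t, tail T tstar t -> - A <= m3 t <= A;
  nc_v : forall t, tail T tstar t -> m3 t * X t = v t + m2 t / 2;
  nc_energy : forall t, tail T tstar t -> - B <= w t ^ 2 + v t ^ 2 - X t <= B;
  nc_large : forall t, tail T tstar t -> 8 * B + 16 * A + 2 * A ^ 2 + 4 <= X t;
  nc_unbounded : forall T' b, tail T tstar T' -> exists t, tail T' tstar t /\ b < X t;
  nc_dX : forall t, tail T tstar t -> is_derive X t (- 2 * w t * (1 + X t ^ 2));
  nc_dw : forall t, tail T tstar t -> is_derive w t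
    (- 1 - X t ^ 2 + 2 * X t * v t ^ 2 + 2 * m3 t * v t - X t * m3 t ^ 2 / 2);
  nc_dv : forall t, tail T tstar t -> is_derive v t
    (- 2 * w t * X t * v t - 3 / 2 * w t * m3 t + m1 t * m3 t / 4);
  nc_dm1 : forall t, tail T tstar t -> is_derive m1 t
    (X t * m3 t ^ 2 + 2 * m2 t * (X t * v t));
  nc_dm2 : forall t, tail T tstar t -> is_derive m2 t
    (- 2 * m1 t * (X t * v t) - m3 t * (w t + m1 t / 2));
  nc_dm3 : forall t, tail T tstar t -> is_derive m3 t (m2 t * w t - m1 t * v t)
}.

Arguments nc_pos {T tstar A B m1 m2 m3 X w v} _.
Arguments nc_lt {T tstar A B m1 m2 m3 X w v} _.
Arguments nc_A {T tstar A B m1 m2 m3 X w v} _.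
Arguments nc_B {T tstar A B m1 m2 m3 X w v} _.
Arguments nc_m1 {T tstar A B m1 m2 m3 X w v} _ t _.
Arguments nc_m2 {T tstar A B m1 m2 m3 X w v} _ t _.
Arguments nc_m3 {T tstar A B m1 m2 m3 X w v} _ t _.
Arguments nc_v {T tstar A B m1 m2 m3 X w v} _ t _.
Arguments nc_energy {T tstar A B m1 m2 m3 X w v} _ t _.
Arguments nc_large {T tstar A B m1 m2 m3 X w v} _ t _.
Arguments nc_unbounded {T tstar A B m1 m2 m3 X w v} _ T' b _.
Arguments nc_dX {T tstar A B m1 m2 m3 X w v} _ t _.
Arguments nc_dw {T tstar A B m1 m2 m3 X w v} _ t _.
Arguments nc_dv {T tstar A B m1 m2 m3 X w v} _ t _.
Arguments nc_dm1 {T tstar A B m1 m2 m3 X w v} _ t _.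
Arguments nc_dm2 {T tstar A B m1 m2 m3 X w v} _ t _.
Arguments nc_dm3 {T tstar A B m1 m2 m3 X w v} _ t _.

(** When the radial velocity [w] is small against [sqrt X], the centrifugal term
    [2 X v^2] outweighs the attraction [- X^2]. *)
Lemma slow_infall_decelerates : forall A B X w v m3 : R,
  1 <= A -> 1 <= B -> 8 * B + 16 * A + 2 * A ^ 2 + 4 <= X ->
  - A <= m3 <= A -> - B <= w ^ 2 + v ^ 2 - X <= B -> 4 * w ^ 2 <= X ->
  X ^ 2 / 4 <= - 1 - X ^ 2 + 2 * X * v ^ 2 + 2 * m3 * v - X * m3 ^ 2 / 2.
Proof.
  intros A B X w v m3 HA HB HX Hm He Hw.
  assert (HX1 : 1 <= X) by nra.
  assert (Hv2 : 3 * X / 4 - B <= v ^ 2 <= 2 * X) by nra.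
  assert (Hv : - (2 * X) <= v <= 2 * X) by nra.
  assert (H1 : - (2 * A * X) <= m3 * v) by nra.
  assert (H2 : m3 ^ 2 <= A ^ 2) by nra.
  assert (H3 : X * (3 * X / 4 - B) <= X * v ^ 2) by nra.
  assert (H4 : X * m3 ^ 2 <= X * A ^ 2) by nra.
  assert (H5 : X * (8 * B + 16 * A + 2 * A ^ 2 + 4) <= X * X) by nra.
  nra.
Qed.

(** The two bodies approach each other until the collision. *)
Lemma infall_negative : forall {T tstar A B m1 m2 m3 X w v},
  near_collision T tstar A B m1 m2 m3 X w v ->
  forall t, tail T tstar t -> w t < 0.
Proof.
  intros T tstar A B m1 m2 m3 X w v N t0 Ht0.
  apply Rnot_le_lt; intros Hw0.
  assert (sub : forall t, tail t0 tstar t -> tail T tstar t)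
    by (intros t; apply tail_weaken, Ht0).
  assert (Ht00 : tail t0 tstar t0) by (split; [lra | apply Ht0]).
  assert (Hw : forall t, tail t0 tstar t -> 0 <= w t).
  { intros t Ht; enough (- w t <= 0) by lra.
    apply (barrier t0 tstar (fun s => - w s) (fun s => -
      (- 1 - X s ^ 2 + 2 * X s * v s ^ 2 + 2 * m3 s * v s - X s * m3 s ^ 2 / 2)))
      with (a := t0); auto; try lra; [| |apply Ht].
    - intros s Hs; apply (is_derive_opp w), (nc_dw N); auto.
    - intros s Hs Hz; apply sub in Hs.
      pose proof (nc_large N s Hs).
      pose proof (nc_A N).
      pose proof (nc_B N).
      assert (Hz' : w s = 0) by lra.
      pose proof (slow_infall_decelerates A B (X s) (w s) (v s) (m3 s)) as K.
      specialize (K ltac:(lra) ltac:(lra) ltac:(lra)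
        (nc_m3 N s Hs) (nc_energy N s Hs)
        ltac:(rewrite Hz'; nra)).
      nra. }
  destruct (nc_unbounded N t0 (X t0) Ht0) as (t & Ht & HXt).
  assert (X t <= X t0); [| lra].
  apply (nonincreasing_of_derive t0 tstar X (fun s => - 2 * w s * (1 + X s ^ 2)));
    auto; [| | apply Ht].
  - intros s Hs; apply (nc_dX N); auto.
  - intros s Hs; pose proof (Hw s Hs); pose proof (pow2_ge_0 (X s)).
    assert (0 <= w s * (1 + X s ^ 2)) by (apply Rmult_le_pos; lra); lra.
Qed.

Lemma infall_fast : forall {T tstar A B m1 m2 m3 X w v},
  near_collision T tstar A B m1 m2 m3 X w v ->
  forall t, tail T tstar t -> X t < 4 * w t ^ 2.
Proof.
  intros T tstar A B m1 m2 m3 X w v N t0 Ht0.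
  apply Rnot_le_lt; intros Hw0.
  assert (sub : forall t, tail t0 tstar t -> tail T tstar t)
    by (intros t; apply tail_weaken, Ht0).
  assert (Ht00 : tail t0 tstar t0) by (split; [lra | apply Ht0]).
  pose (dw := fun s =>
    - 1 - X s ^ 2 + 2 * X s * v s ^ 2 + 2 * m3 s * v s - X s * m3 s ^ 2 / 2).
  assert (Hdw : forall s, tail t0 tstar s -> is_derive w s (dw s))
    by (intros s Hs; apply (nc_dw N); auto).
  assert (HdX : forall s, tail t0 tstar s -> is_derive X s (- 2 * w s * (1 + X s ^ 2)))
    by (intros s Hs; apply (nc_dX N); auto).
  assert (Hneg : forall s, tail t0 tstar s -> w s < 0)
    by (intros s Hs; apply (infall_negative N); auto).
  assert (HX4 : forall s, tail t0 tstar s -> 4 <= X s).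
  { intros s Hs; apply sub in Hs.
    pose proof (nc_large N s Hs).
    pose proof (nc_A N).
    pose proof (nc_B N); nra. }
  assert (Hdw4 : forall s, tail t0 tstar s -> 4 * w s ^ 2 <= X s -> X s ^ 2 / 4 <= dw s).
  { intros s Hs Hle; apply sub in Hs.
    apply (slow_infall_decelerates A B (X s) (w s) (v s) (m3 s)); auto;
      apply N; auto. }
  assert (Hslow : forall t, tail t0 tstar t -> 4 * w t ^ 2 <= X t).
  { intros t Ht; enough (4 * w t ^ 2 - X t <= 0) by lra.
    apply (barrier t0 tstar (fun s => 4 * w s ^ 2 - X s)
      (fun s => 8 * w s * dw s - (- 2 * w s * (1 + X s ^ 2))))
      with (a := t0); auto; try lra; [| | apply Ht].
    - intros s Hs; evar_last.
      + apply (is_derive_minus (fun s => 4 * w s ^ 2) X).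
        * apply (is_derive_scal (fun s => w s ^ 2)), is_derive_pow, Hdw, Hs.
        * apply HdX, Hs.
      + unfold minus, plus, opp, scal; simpl; unfold mult; simpl; ring.
    - intros s Hs Hz.
      pose proof (Hneg s Hs); pose proof (HX4 s Hs).
      pose proof (Hdw4 s Hs ltac:(lra)).
      nra. }
  destruct (nc_unbounded N t0 (X t0 + 8 * w t0 ^ 2) Ht0)
    as (t & Ht & HXt).
  assert (X t + 8 * w t ^ 2 <= X t0 + 8 * w t0 ^ 2); [| pose proof (pow2_ge_0 (w t)); lra].
  apply (nonincreasing_of_derive t0 tstar (fun s => X s + 8 * w s ^ 2)
    (fun s => - 2 * w s * (1 + X s ^ 2) + 16 * w s * dw s));
    auto; [| | apply Ht].
  - intros s Hs; evar_last.
    + apply (is_derive_plus X (fun s => 8 * w s ^ 2)).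
      * apply HdX, Hs.
      * apply (is_derive_scal (fun s => w s ^ 2)), is_derive_pow, Hdw, Hs.
    + unfold minus, plus, opp, scal; simpl; unfold mult; simpl; ring.
  - intros s Hs; pose proof (Hneg s Hs); pose proof (HX4 s Hs).
    pose proof (Hdw4 s Hs (Hslow s Hs)).
    assert (0 <= - w s * (16 * dw s - 2 * (1 + X s ^ 2))) by (apply Rmult_le_pos; nra).
    lra.
Qed.

Lemma infall_unit_speed : forall {T tstar A B m1 m2 m3 X w v},
  near_collision T tstar A B m1 m2 m3 X w v ->
  forall t, tail T tstar t -> 30 <= X t /\ w t <= - 1.
Proof.
  intros T tstar A B m1 m2 m3 X w v N t Ht.
  pose proof (infall_negative N t Ht).
  pose proof (infall_fast N t Ht).
  pose proof (nc_large N t Ht).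
  pose proof (nc_A N); pose proof (nc_B N).
  assert (1 <= A ^ 2) by nra.
  split; nra.
Qed.

(** For [e = 1] and [e = - 1], the function [e v / X + K / X^2] is nonincreasing
    and, since [v^2 <= 2 X], tends to [0]; so it is nonnegative. *)
Lemma angular_momentum_signed_bound : forall {T tstar A B m1 m2 m3 X w v},
  near_collision T tstar A B m1 m2 m3 X w v ->
  forall e t, e ^ 2 = 1 -> tail T tstar t ->
  0 <= e * (v t / X t) + (A ^ 2 + 2 * A + 4) / X t ^ 2.
Proof.
  intros T tstar A B m1 m2 m3 X w v N e t0 He Ht0.
  (* Otherwise the function stays below [- d < 0], hence [d^2 <= (v / X)^2 <= 2 / X]
     at all later times, which fails when [X > 2 / d^2]. *)
  apply Rnot_lt_le; intros Hneg.
  set (K := A ^ 2 + 2 * A + 4) in *.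
  pose (y := fun s => e * (v s / X s) + K / X s ^ 2).
  pose (d := - y t0); assert (Hd : 0 < d) by (unfold d, y; lra).
  pose proof (nc_A N) as HA.
  pose proof (nc_B N) as HB.
  assert (He1 : - 1 <= e <= 1) by nra.
  assert (sub : forall t, tail t0 tstar t -> tail T tstar t)
    by (intros t; apply tail_weaken, Ht0).
  assert (Ht00 : tail t0 tstar t0) by (split; [lra | apply Ht0]).
  assert (Hv : forall s, tail T tstar s -> v s ^ 2 <= 2 * X s).
  { intros s Hs; pose proof (nc_energy N s Hs).
    pose proof (nc_large N s Hs); nra. }
  destruct (nc_unbounded N t0 (2 / d ^ 2) Ht0) as (t & Ht & HXt).
  assert (Hy : y t <= y t0).
  { apply (nonincreasing_of_derive t0 tstar y
      (fun s => e * ((- 3 / 2 * w s * m3 s + m1 s * m3 s / 4) / X s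
                     + 2 * w s * v s / X s ^ 2)
                + K * (4 * w s * (1 + X s ^ 2) / X s ^ 3)));
    auto; [| | apply Ht].
    - intros s Hs; apply sub in Hs.
      pose proof (infall_unit_speed N s Hs) as [HX _].
      pose proof (nc_dX N s Hs) as DX.
      pose proof (nc_dv N s Hs) as Dv.
      unfold y; auto_derive.
      + repeat split; try (eexists; eassumption); simpl; try nra.
      + rewrite (is_derive_unique (fun x : R => X x) _ _ DX),
          (is_derive_unique (fun x : R => v x) _ _ Dv); field; lra.
    - intros s Hs; apply sub in Hs.
      pose proof (infall_unit_speed N s Hs) as [HX Hw].
      pose proof (nc_m1 N s Hs) as H1.
      pose proof (nc_m3 N s Hs) as H3.
      specialize (Hv s Hs).
      assert (Hv2 : - (2 * X s) <= v s <= 2 * X s) by nra.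
      set (a := e * (- 3 / 2 * w s * m3 s + m1 s * m3 s / 4)).
      set (b := e * v s).
      assert (Hb : - (2 * X s) <= b) by (unfold b; nra).
      assert (Em : - A <= e * m3 s <= A) by nra.
      assert (Ha : a <= - w s * (3 / 2 * A + A ^ 2 / 4)).
      { replace a with (- w s * (3 / 2 * (e * m3 s)) + m1 s * (e * m3 s) / 4)
          by (unfold a; field).
        assert (m1 s * (e * m3 s) <= A ^ 2) by nra.
        assert (- w s * (e * m3 s) <= - w s * A) by nra.
        assert (A ^ 2 <= - w s * A ^ 2) by nra.
        lra. }
      replace (e * ((- 3 / 2 * w s * m3 s + m1 s * m3 s / 4) / X s
                    + 2 * w s * v s / X s ^ 2)
                + K * (4 * w s * (1 + X s ^ 2) / X s ^ 3))
        with (- ((- (a * X s ^ 2 + 2 * w s * b * X s + 4 * K * w s * (1 + X s ^ 2)))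
               * (/ X s ^ 3)))
        by (unfold a, b; field; lra).
      assert (0 <= / X s ^ 3) by (apply Rlt_le, Rinv_0_lt_compat, pow_lt; lra).
      enough (0 <= - (a * X s ^ 2 + 2 * w s * b * X s + 4 * K * w s * (1 + X s ^ 2)))
        by (enough (0 <= (- (a * X s ^ 2 + 2 * w s * b * X s
              + 4 * K * w s * (1 + X s ^ 2))) * / X s ^ 3) by lra;
            apply Rmult_le_pos; assumption).
      assert (HX2 : 0 <= X s ^ 2) by apply pow2_ge_0.
      assert (T1 : a * X s ^ 2 <= - w s * (3 / 2 * A + A ^ 2 / 4) * X s ^ 2)
        by (apply Rmult_le_compat_r; assumption).
      assert (T2 : 2 * w s * b * X s <= - w s * 4 * X s ^ 2).
      { assert (0 <= (- w s * X s) * (b + 2 * X s)) by (apply Rmult_le_pos; nra); lra. }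
      assert (T3 : 0 <= - w s * X s ^ 2) by (apply Rmult_le_pos; lra).
      assert (T4 : 0 <= (- w s * X s ^ 2) * (4 * K - 3 / 2 * A - A ^ 2 / 4 - 4)).
      { apply Rmult_le_pos; [exact T3 | unfold K; nra]. }
      assert (0 <= - w s * K) by (apply Rmult_le_pos; unfold K; nra).
      lra. }
  apply sub in Ht; specialize (Hv t Ht).
  pose proof (infall_unit_speed N t Ht) as [HX _].
  assert (Hle : e * (v t / X t) <= - d).
  { assert (0 <= K / X t ^ 2).
    { apply Rmult_le_pos; [unfold K; nra | apply Rlt_le, Rinv_0_lt_compat, pow_lt; lra]. }
    unfold d; change (y t <= y t0) in Hy; unfold y at 1 in Hy; lra. }
  assert (Hsq : d ^ 2 <= (v t / X t) ^ 2).
  { replace ((v t / X t) ^ 2) with ((e * (v t / X t)) ^ 2)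
      by (rewrite Rpow_mult_distr, He; ring).
    nra. }
  assert (Hq : (v t / X t) ^ 2 * X t <= 2).
  { replace ((v t / X t) ^ 2 * X t) with (v t ^ 2 / X t) by (field; lra).
    apply Rle_div_l; lra. }
  assert (Hd2 : 0 < d ^ 2) by (apply pow_lt, Hd).
  apply Rlt_div_l in HXt; [nra | exact Hd2].
Qed.

Lemma angular_momentum_bound : forall {T tstar A B m1 m2 m3 X w v},
  near_collision T tstar A B m1 m2 m3 X w v ->
  forall t, tail T tstar t ->
  - (A ^ 2 + 2 * A + 4) <= X t * v t <= A ^ 2 + 2 * A + 4.
Proof.
  intros T tstar A B m1 m2 m3 X w v N t Ht.
  pose proof (infall_unit_speed N t Ht) as [HX _].
  pose proof (angular_momentum_signed_bound N 1 t ltac:(ring) Ht) as H1.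
  pose proof (angular_momentum_signed_bound N (- 1) t ltac:(ring) Ht) as H2.
  set (K := A ^ 2 + 2 * A + 4) in *.
  assert (HX2 : 0 < X t ^ 2) by (apply pow_lt; lra).
  replace (1 * (v t / X t) + K / X t ^ 2) with ((X t * v t + K) / X t ^ 2) in H1
    by (field; lra).
  replace (- 1 * (v t / X t) + K / X t ^ 2) with ((- (X t * v t) + K) / X t ^ 2) in H2
    by (field; lra).
  apply Rle_div_r in H1; [| exact HX2]; apply Rle_div_r in H2; [| exact HX2].
  lra.
Qed.

Lemma velocity_bound : forall {T tstar A B m1 m2 m3 X w v},
  near_collision T tstar A B m1 m2 m3 X w v ->
  exists K, 0 <= K /\ forall t, tail T tstar t ->
    Rabs (Derive m1 t) <= K * - w t /\
    Rabs (Derive m2 t) <= K * - w t /\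
    Rabs (Derive m3 t) <= K * - w t.
Proof.
  intros T tstar A B m1 m2 m3 X w v N.
  pose proof (nc_A N) as HA.
  exists (3 * A * (A ^ 2 + 2 * A + 4) + A ^ 2 + A).
  split; [nra|]; intros t Ht.
  pose proof (infall_unit_speed N t Ht) as [HX Hw].
  pose proof (angular_momentum_bound N t Ht) as HXv.
  pose proof (nc_m1 N t Ht) as H1.
  pose proof (nc_m2 N t Ht) as H2.
  pose proof (nc_m3 N t Ht) as H3.
  pose proof (nc_v N t Ht) as Hv.
  rewrite (is_derive_unique _ _ _ (nc_dm1 N t Ht)).
  rewrite (is_derive_unique _ _ _ (nc_dm2 N t Ht)).
  rewrite (is_derive_unique _ _ _ (nc_dm3 N t Ht)).
  replace (X t * m3 t ^ 2) with (m3 t * (v t + m2 t / 2)) by (rewrite <- Hv; ring).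
  set (K := A ^ 2 + 2 * A + 4) in *.
  assert (HK : 7 <= K) by (unfold K; nra).
  assert (Hvb : - K <= v t <= K) by nra.
  set (z := X t * v t) in *.
  assert (Hp : forall x y a b, - a <= x <= a -> - b <= y <= b ->
            - (a * b) <= x * y <= a * b).
  { intros x y a b Hx Hy; apply Rabs_le_between.
    rewrite Rabs_mult; apply Rmult_le_compat; try apply Rabs_pos;
      apply Rabs_le_between; assumption. }
  assert (Hw' : w t <= w t <= - w t) by lra.
  pose proof (Hp _ _ _ _ H3 (conj (proj1 Hvb) (proj2 Hvb))) as P3v.
  pose proof (Hp _ _ _ _ H3 H2) as P32.
  pose proof (Hp _ _ _ _ H2 HXv) as P2z.
  pose proof (Hp _ _ _ _ H1 HXv) as P1z.
  pose proof (Hp _ _ _ _ H3 H1) as P31.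
  pose proof (Hp _ _ _ _ H1 Hvb) as P1v.
  assert (P3w : - (A * - w t) <= m3 t * w t <= A * - w t) by (apply Hp; lra).
  assert (P2w : - (A * - w t) <= m2 t * w t <= A * - w t) by (apply Hp; lra).
  assert (HAK : 0 <= A * K) by nra.
  assert (Q1 : A * K <= A * K * - w t) by nra.
  assert (Q2 : A * A <= A * A * - w t) by nra.
  assert (Q3 : 0 <= A * - w t) by nra.
  repeat split; apply Rabs_le_between; lra.
Qed.

#[local] Instance before_filter : forall tstar, Filter (before tstar).
Proof. intros tstar; apply within_filter, Rbar_locally_filter. Qed.

(** Since [(1 / X)' <= 2 w < 0], a function with [|f'| <= K |w|] is such that
    [f + K / X] and [- f + K / X] are nonincreasing. *)
Lemma converges_of_velocity_bound :
  forall {T tstar A B m1 m2 m3 X w v} (f df : R -> R) K,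
  near_collision T tstar A B m1 m2 m3 X w v -> 0 <= K ->
  (forall t, tail T tstar t -> is_derive f t (df t)) ->
  (forall t, tail T tstar t -> Rabs (df t) <= K * - w t) ->
  exists l, filterlim f (before tstar) (locally l).
Proof.
  intros T tstar A B m1 m2 m3 X w v f df K N HK Hf Hdf.
  assert (HTT : tail T tstar T) by (split; [lra | apply N]).
  assert (Mono : forall g dg : R -> R, (forall t, tail T tstar t -> is_derive g t (dg t)) ->
     (forall t, tail T tstar t -> Rabs (dg t) <= K * - w t) ->
     forall a b, tail T tstar a -> tail T tstar b -> a <= b ->
     g b + K / X b <= g a + K / X a).
  { intros g dg Hg Hdg; apply (nonincreasing_of_derive T tstar (fun s => g s + K / X s)
      (fun s => dg s + K * (2 * w s * (1 + / X s ^ 2)))).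
    - intros s Hs.
      pose proof (infall_unit_speed N s Hs) as [HX _].
      pose proof (nc_dX N s Hs) as DX; pose proof (Hg s Hs) as Dg.
      auto_derive.
      + repeat split; try (eexists; eassumption); lra.
      + rewrite (is_derive_unique (fun x : R => X x) _ _ DX),
          (is_derive_unique (fun x : R => g x) _ _ Dg); field; lra.
    - intros s Hs; pose proof (Hdg s Hs) as H; apply Rabs_le_between in H.
      pose proof (infall_unit_speed N s Hs) as [HX Hw].
      assert (0 <= / X s ^ 2) by (apply Rlt_le, Rinv_0_lt_compat, pow_lt; lra).
      assert (0 <= K * - w s) by nra.
      assert (0 <= K * - w s * / X s ^ 2) by (apply Rmult_le_pos; assumption).
      lra. }
  assert (Inv : forall t, tail T tstar t -> 0 <= K / X t).
  { intros t Ht; pose proof (infall_unit_speed N t Ht) as [HX _].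
    apply Rmult_le_pos; [exact HK | apply Rlt_le, Rinv_0_lt_compat; lra]. }
  pose proof (Mono f df Hf Hdf) as Mf.
  pose proof (Mono (fun s => - f s) (fun s => - df s)
    ltac:(intros t Ht; apply (is_derive_opp f), Hf, Ht)
    ltac:(intros t Ht; cbv beta; rewrite Rabs_Ropp; apply Hdf, Ht)) as Mopp.
  destruct (nonincreasing_converges T tstar (fun s => f s + K / X s) (f T - K / X T))
    as [l1 Hl1]; try apply N; [exact Mf | |].
  { intros t Ht; pose proof (Mopp T t HTT Ht (proj1 Ht)); pose proof (Inv t Ht); lra. }
  destruct (nonincreasing_converges T tstar (fun s => K / X s) 0)
    as [l2 Hl2]; try apply N; [| exact Inv |].
  { intros a b Ha Hb Hab.
    pose proof (Mono (fun _ => 0) (fun _ => 0)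
      ltac:(intros t Ht; apply (is_derive_const 0))
      ltac:(intros t Ht; cbv beta; rewrite Rabs_R0;
            pose proof (infall_unit_speed N t Ht); nra)
      a b Ha Hb Hab); lra. }
  exists (l1 - l2).
  apply filterlim_ext with (fun s => (f s + K / X s) - K / X s); [intros; ring|].
  apply (filterlim_comp_2 (fun s => f s + K / X s) (fun s => - (K / X s)) Rplus Hl1
           (H := locally (- l2))).
  - apply (filterlim_comp _ _ _ _ Ropp _ (locally l2) _ Hl2), (filterlim_opp l2).
  - apply (filterlim_plus l1 (- l2)).
Qed.

(** * From one-sided derivatives to derivatives and continuity *)

Lemma dom_open : forall tstar t, dom tstar t -> 0 < t -> locally t (dom tstar).
Proof.
  intros tstar t [_ Ht] H0.
  apply filter_and with (P := fun s => 0 <= s) (Q := fun s : R => Rbar_lt s tstar).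
  - apply filter_imp with (fun s => 0 < s); [intros s; lra|].
    apply (open_gt 0), H0.
  - apply (open_Rbar_lt tstar), Ht.
Qed.

Lemma is_derive_of_D_in : forall tstar f d t,
  dom tstar t -> 0 < t -> D_in f d (dom tstar) t -> is_derive f t (d t).
Proof.
  intros tstar f d t Ht H0 HD; apply is_derive_Reals.
  destruct (dom_open tstar t Ht H0) as [r Hr].
  intros eps Heps; destruct (HD eps Heps) as (a & Ha & Hlim).
  assert (Hd : 0 < Rmin a r) by (apply Rmin_glb_lt; [exact Ha | apply cond_pos]).
  exists (mkposreal _ Hd); intros h Hh Hlt; simpl in Hlt.
  pose proof (Rmin_l a r); pose proof (Rmin_r a r).
  replace h with (t + h - t) at 2 by ring.
  apply Hlim; split.
  - split; [apply Hr, ball_R; apply Rabs_def2 in Hlt; lra | lra].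
  - simpl; unfold Rdist; replace (t + h - t) with h by ring; lra.
Qed.

(** Precomposition with [Rmax 0] extends a function on [0, tstar) by a constant to
    negative times, which makes it continuous on both sides of [0]. *)
Lemma continuous_of_D_in : forall tstar f d t,
  dom tstar t -> D_in f d (dom tstar) t -> continuous (fun s => f (Rmax 0 s)) t.
Proof.
  intros tstar f d t Ht HD.
  pose proof (cont_deriv f d (dom tstar) t HD) as Hc.
  assert (Et : Rmax 0 t = t) by (apply Rmax_right, Ht).
  apply filterlim_locally; intros eps; rewrite Et.
  destruct (Hc eps (cond_pos eps)) as (a & Ha & Hlim).
  assert (Ho : locally t (fun s : R => Rbar_lt s tstar))
    by (apply (open_Rbar_lt tstar), Ht).
  assert (H0 : Rbar_lt 0 tstar)
    by (apply Rbar_le_lt_trans with (Finite t); apply Ht).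
  apply (filter_imp (fun s : R => Rbar_lt s tstar /\ ball t (mkposreal a Ha) s)).
  - intros s [Hs Hb]; apply ball_R in Hb; simpl in Hb.
    destruct (Req_dec (Rmax 0 s) t) as [E|E]; [rewrite E; apply ball_center|].
    assert (K : Rabs (f (Rmax 0 s) - f t) < eps).
    { apply Hlim; split.
      - split; [|congruence]; split; [apply Rmax_l|].
        unfold Rmax; destruct (Rle_dec 0 s); assumption.
      - simpl; unfold Rdist; destruct Ht as [Ht _].
        unfold Rmax; destruct (Rle_dec 0 s); apply Rabs_def1; lra. }
    apply ball_R; apply Rabs_def2 in K; lra.
  - apply filter_and; [exact Ho | apply locally_ball].
Qed.

(** * The reduced system in terms of the cotangent *)

Lemma sin_neq_0 : forall x, 0 < x < PI -> sin x <> 0.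
Proof. intros x Hx; pose proof (sin_gt_0 x (proj1 Hx) (proj2 Hx)); lra. Qed.

Lemma csc_sqr : forall x, sin x <> 0 -> csc x ^ 2 = 1 + cot x ^ 2.
Proof.
  intros x Hx; unfold csc, cot.
  pose proof (sin2_cos2 x) as E; unfold Rsqr in E.
  replace (1 + (cos x / sin x) ^ 2) with ((sin x * sin x + cos x * cos x) / sin x ^ 2)
    by (field; exact Hx).
  rewrite E; field; exact Hx.
Qed.

Lemma is_derive_cot : forall x, sin x <> 0 -> is_derive cot x (- (1 + cot x ^ 2)).
Proof.
  intros x Hx; unfold cot; auto_derive; [auto|field; exact Hx].
Qed.

Lemma cot_large : forall b, exists eps : posreal, forall x, 0 < x < eps -> b < cot x.
Proof.
  intros b.
  assert (Hc : 0 < / (2 * (Rabs b + 1)))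
    by (apply Rinv_0_lt_compat; pose proof (Rabs_pos b); lra).
  exists (mkposreal _ Hc); simpl; intros x [H0 Hx].
  pose proof (Rabs_pos b); pose proof PI2_3_2.
  assert (Hx2 : x * (2 * (Rabs b + 1)) < 1).
  { apply Rlt_div_r; [lra | unfold Rdiv; lra]. }
  assert (Hx1 : x < 1) by nra.
  assert (Hs : 0 < sin x < x) by (split; [apply sin_gt_0; lra | apply sin_lt_x, H0]).
  assert (Hcos : 1 / 2 < cos x).
  { rewrite <- cos_PI3; apply cos_decreasing_1; lra. }
  unfold cot; apply Rlt_div_r; [lra|].
  pose proof (Rle_abs b); nra.
Qed.

Lemma cot_tends_to_infinity : forall tstar m1 m2 m3 q p,
  collision_trajectory tstar m1 m2 m3 q p ->
  forall b, before tstar (fun t => b < cot (q t)).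
Proof.
  intros tstar m1 m2 m3 q p (_ & Hsol & Hq) b.
  destruct (cot_large b) as [eps Heps].
  pose proof (proj1 (filterlim_locally q 0) Hq eps) as Hb.
  unfold before, within in *; revert Hb; apply filter_imp.
  intros t Hb Ht; specialize (Hb Ht); apply ball_R in Hb.
  apply Heps; pose proof (proj1 (Hsol t Ht)); lra.
Qed.

(** The equations with [csc^2] replaced by [1 + cot^2], and with the equation for
    [q] replaced by that for [cot q]. *)
Lemma reduced_equations : forall tstar m1 m2 m3 q p,
  reduced_solution tstar m1 m2 m3 q p ->
  forall t, dom tstar t -> 0 < t ->
  let X := cot (q t) in
  is_derive m1 t (X * (- m2 t ^ 2 + m3 t ^ 2 + 2 * m2 t * m3 t * X)) /\
  is_derive m2 t (m1 t * m2 t * X - m3 t * p t - 2 * m1 t * m3 t * X ^ 2) /\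
  is_derive m3 t (m2 t * p t - m1 t * m3 t * X) /\
  is_derive (fun s => cot (q s)) t (- (1 + X ^ 2) * (2 * p t - m1 t)) /\
  is_derive p t (- (1 + X ^ 2) * (1 + m2 t * m3 t - 2 * m3 t ^ 2 * X)).
Proof.
  intros tstar m1 m2 m3 q p Hsol t Ht H0 X.
  destruct (Hsol t Ht) as (Hq & D1 & D2 & D3 & Dq & Dp).
  apply is_derive_of_D_in in D1, D2, D3, Dq, Dp; try assumption.
  pose proof (csc_sqr (q t) (sin_neq_0 _ Hq)) as E.
  refine (conj _ (conj _ (conj _ (conj _ _)))).
  - exact D1.
  - evar_last; [exact D2 | cbv beta; rewrite E; unfold X; ring].
  - exact D3.
  - evar_last; [apply (is_derive_comp cot q _ _ _ (is_derive_cot _ (sin_neq_0 _ Hq)) Dq)|].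
    unfold scal; simpl; unfold mult; simpl; unfold X; ring.
  - evar_last; [exact Dp | cbv beta; rewrite E; unfold X; ring].
Qed.

Lemma casimir_derive : forall tstar m1 m2 m3 q p,
  reduced_solution tstar m1 m2 m3 q p ->
  forall t, dom tstar t -> 0 < t ->
  is_derive (fun s => casimir (m1 s) (m2 s) (m3 s)) t 0.
Proof.
  intros tstar m1 m2 m3 q p Hsol t Ht H0.
  destruct (reduced_equations _ _ _ _ _ _ Hsol t Ht H0) as (D1 & D2 & D3 & _).
  unfold casimir; auto_derive.
  - repeat split; eexists; eassumption.
  - rewrite (is_derive_unique (fun x : R => m1 x) _ _ D1),
      (is_derive_unique (fun x : R => m2 x) _ _ D2),
      (is_derive_unique (fun x : R => m3 x) _ _ D3); ring.
Qed.

(** * Conserved quantities *)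

Lemma cont_const : forall c t : R, continuous (fun _ : R => c) t.
Proof. intros c t; apply continuous_const. Qed.

Lemma cont_plus : forall (f g : R -> R) t,
  continuous f t -> continuous g t -> continuous (fun s => f s + g s) t.
Proof. intros f g t; apply (continuous_plus f g). Qed.

Lemma cont_opp : forall (f : R -> R) t,
  continuous f t -> continuous (fun s => - f s) t.
Proof. intros f t; apply (continuous_opp f). Qed.

Lemma cont_minus : forall (f g : R -> R) t,
  continuous f t -> continuous g t -> continuous (fun s => f s - g s) t.
Proof. intros f g t; apply (continuous_minus f g). Qed.

Lemma cont_mult : forall (f g : R -> R) t,
  continuous f t -> continuous g t -> continuous (fun s => f s * g s) t.
Proof. intros f g t; apply (continuous_mult f g). Qed.

Lemma cont_pow : forall (f : R -> R) n t,
  continuous f t -> continuous (fun s => f s ^ n) t.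
Proof.
  intros f n t Hf; induction n as [|n IH]; simpl;
    [apply cont_const | apply (cont_mult f (fun s => f s ^ n)); assumption].
Qed.

(** Continuity of an arithmetic expression from that of its atoms. *)
Ltac continuity_tac :=
  lazymatch goal with
  | |- continuous (fun s => @?f s + @?g s) _ => apply (cont_plus f g); continuity_tac
  | |- continuous (fun s => @?f s - @?g s) _ => apply (cont_minus f g); continuity_tac
  | |- continuous (fun s => - @?f s) _ => apply (cont_opp f); continuity_tac
  | |- continuous (fun s => @?f s * @?g s) _ => apply (cont_mult f g); continuity_tac
  | |- continuous (fun s => @?f s ^ ?n) _ => apply (cont_pow f n); continuity_tac
  | |- continuous (fun _ => ?c) _ => apply (cont_const c)
  | _ => assumption
  end.

Lemma casimir_constant : forall tstar m1 m2 m3 q p,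
  reduced_solution tstar m1 m2 m3 q p ->
  forall t, dom tstar t ->
  casimir (m1 t) (m2 t) (m3 t) = casimir (m1 0) (m2 0) (m3 0).
Proof.
  intros tstar m1 m2 m3 q p Hsol t Ht.
  pose (g := fun s => casimir (m1 (Rmax 0 s)) (m2 (Rmax 0 s)) (m3 (Rmax 0 s))).
  assert (H0 : 0 <= t) by apply Ht.
  assert (Hdom : forall s, 0 <= s <= t -> dom tstar s).
  { intros s Hs; split; [lra|].
    apply Rbar_le_lt_trans with (Finite t); [apply Hs | apply Ht]. }
  destruct (MVT_gen g 0 t (fun _ => 0)) as (c & _ & E).
  - intros s; rewrite Rmin_left, Rmax_right by lra; intros Hs.
    apply (is_derive_ext_loc (fun s => casimir (m1 s) (m2 s) (m3 s))).
    + apply filter_imp with (fun y => 0 < y); [|apply (open_gt 0), Hs].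
      intros y Hy; unfold g; rewrite Rmax_right by lra; reflexivity.
    + apply (casimir_derive _ _ _ _ _ _ Hsol); [apply Hdom; lra | apply Hs].
  - intros s; rewrite Rmin_left, Rmax_right by lra; intros Hs.
    apply continuity_pt_filterlim.
    destruct (Hsol s (Hdom s Hs)) as (_ & D1 & D2 & D3 & _).
    apply (continuous_of_D_in _ _ _ _ (Hdom s Hs)) in D1, D2, D3.
    change (continuous g s); unfold g, casimir; continuity_tac.
  - unfold g in E; rewrite !(Rmax_right 0 t), !(Rmax_right 0 0) in E by lra; lra.
Qed.

(** The conserved function is the Hamiltonian minus half of the Casimir function. *)
Lemma energy_derive : forall tstar m1 m2 m3 q p,
  reduced_solution tstar m1 m2 m3 q p ->
  forall t, dom tstar t -> 0 < t ->
  is_derive (fun s => p s ^ 2 - m1 s * p s + (m3 s * cot (q s)) ^ 2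
                      - m2 s * (m3 s * cot (q s)) - cot (q s)) t 0.
Proof.
  intros tstar m1 m2 m3 q p Hsol t Ht H0.
  destruct (reduced_equations _ _ _ _ _ _ Hsol t Ht H0) as (D1 & D2 & D3 & DX & Dp).
  set (X := fun s => cot (q s)) in *; fold (X t) in D1, D2, D3, DX, Dp.
  change (is_derive (fun s => p s ^ 2 - m1 s * p s + (m3 s * X s) ^ 2
                      - m2 s * (m3 s * X s) - X s) t 0).
  change (is_derive X t (- (1 + X t ^ 2) * (2 * p t - m1 t))) in DX.
  clearbody X; auto_derive.
  - repeat split; eexists; eassumption.
  - rewrite (is_derive_unique (fun x : R => m1 x) _ _ D1),
      (is_derive_unique (fun x : R => m2 x) _ _ D2),
      (is_derive_unique (fun x : R => m3 x) _ _ D3),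
      (is_derive_unique (fun x : R => X x) _ _ DX),
      (is_derive_unique (fun x : R => p x) _ _ Dp); ring.
Qed.

(** * Collision trajectories *)

Lemma collision_is_near_collision : forall tstar m1 m2 m3 q p,
  collision_trajectory tstar m1 m2 m3 q p ->
  exists T A B, near_collision T tstar A B m1 m2 m3
    (fun t => cot (q t)) (fun t => p t - m1 t / 2)
    (fun t => m3 t * cot (q t) - m2 t / 2).
Proof.
  intros tstar m1 m2 m3 q p Hcol.
  pose proof (cot_tends_to_infinity _ _ _ _ _ _ Hcol) as Hinf.
  destruct Hcol as (Hpos & Hsol & _).
  destruct (proj1 (before_tail tstar _ Hpos) (Hinf 0)) as (T0 & HT0 & HT0s & _).
  pose (h := fun s => p s ^ 2 - m1 s * p s + (m3 s * cot (q s)) ^ 2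
                      - m2 s * (m3 s * cot (q s)) - cot (q s)).
  pose (A := 1 + casimir (m1 0) (m2 0) (m3 0)).
  assert (HA : 1 <= A) by (unfold A, casimir; nra).
  pose (B := 1 + Rabs (h T0) + A ^ 2).
  destruct (proj1 (before_tail tstar _ Hpos) (Hinf (8 * B + 16 * A + 2 * A ^ 2 + 4)))
    as (T1 & HT1 & HT1s & HX).
  assert (Hdom : forall t, tail (Rmax T0 T1) tstar t -> dom tstar t /\ 0 < t).
  { intros t [H1 H2]; pose proof (Rmax_l T0 T1).
    split; [split; [lra | exact H2] | lra]. }
  assert (Hm : forall t, dom tstar t ->
    (- A <= m1 t <= A) /\ (- A <= m2 t <= A) /\ (- A <= m3 t <= A)).
  { intros t Ht; pose proof (casimir_constant _ _ _ _ _ _ Hsol t Ht) as E.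
    assert (E' : m1 t ^ 2 + m2 t ^ 2 + m3 t ^ 2 = A - 1)
      by (unfold A; rewrite <- E; unfold casimir; ring).
    assert (Hle : forall x, x ^ 2 <= A - 1 -> - A <= x <= A) by (intros x Hx; nra).
    pose proof (pow2_ge_0 (m1 t)); pose proof (pow2_ge_0 (m2 t));
      pose proof (pow2_ge_0 (m3 t)).
    split; [|split]; apply Hle; lra. }
  assert (Hh : forall t, tail (Rmax T0 T1) tstar t -> h t = h T0).
  { intros t Ht.
    assert (Hd : forall s, tail T0 tstar s -> is_derive h s 0).
    { intros s [Hs1 Hs2]; apply (energy_derive _ _ _ _ _ _ Hsol); [|lra].
      split; [lra | exact Hs2]. }
    assert (HT00 : tail T0 tstar T0) by (split; [lra | exact HT0s]).
    assert (Ht0 : tail T0 tstar t)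
      by (apply tail_weaken with (Rmax T0 T1); [apply Rmax_l | exact Ht]).
    apply Rle_antisym.
    - apply (nonincreasing_of_derive T0 tstar h (fun _ => 0)); auto;
        [intros; lra | apply Ht0].
    - enough (- h t <= - h T0) by lra.
      apply (nonincreasing_of_derive T0 tstar (fun s => - h s) (fun _ => 0)); auto;
        [|intros; lra | apply Ht0].
      intros s Hs; evar_last; [apply (is_derive_opp h), Hd, Hs | apply Ropp_0]. }
  exists (Rmax T0 T1), A, B; constructor.
  - apply Rlt_le_trans with T0; [exact HT0 | apply Rmax_l].
  - unfold Rmax; destruct (Rle_dec T0 T1); assumption.
  - exact HA.
  - unfold B; pose proof (Rabs_pos (h T0)); pose proof (pow2_ge_0 A); lra.
  - intros t Ht; apply Hm, Hdom, Ht.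
  - intros t Ht; apply Hm, Hdom, Ht.
  - intros t Ht; apply Hm, Hdom, Ht.
  - intros t _; ring.
  - intros t Ht; specialize (Hh t Ht); unfold h at 1 in Hh.
    destruct (Hm t (proj1 (Hdom t Ht))) as (H1 & H2 & _).
    replace ((p t - m1 t / 2) ^ 2 + (m3 t * cot (q t) - m2 t / 2) ^ 2 - cot (q t))
      with (h T0 + (m1 t ^ 2 + m2 t ^ 2) / 4) by (rewrite <- Hh; field).
    assert (0 <= m1 t ^ 2 <= A ^ 2) by nra; assert (0 <= m2 t ^ 2 <= A ^ 2) by nra.
    pose proof (proj1 (Rabs_le_between (h T0) _) (Rle_refl _)).
    unfold B; lra.
  - intros t Ht; apply Rlt_le, HX, tail_weaken with (Rmax T0 T1); [apply Rmax_r | exact Ht].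
  - intros T' b HT'.
    destruct (proj1 (before_tail tstar _ Hpos) (Hinf b)) as (T2 & HT2 & HT2s & Hb).
    exists (Rmax T' T2).
    assert (Rbar_lt (Rmax T' T2) tstar)
      by (unfold Rmax; destruct (Rle_dec T' T2); [assumption | apply HT']).
    split; [split; [apply Rmax_l | assumption]|].
    apply Hb; split; [apply Rmax_r | assumption].
  - intros t Ht; destruct (Hdom t Ht) as [Hd H0].
    destruct (reduced_equations _ _ _ _ _ _ Hsol t Hd H0) as (D1 & D2 & D3 & DX & Dp).
    evar_last; [exact DX | field].
  - intros t Ht; destruct (Hdom t Ht) as [Hd H0].
    destruct (reduced_equations _ _ _ _ _ _ Hsol t Hd H0) as (D1 & D2 & D3 & DX & Dp).
    auto_derive; [repeat split; eexists; eassumption|].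
    rewrite (is_derive_unique (fun x : R => m1 x) _ _ D1),
      (is_derive_unique (fun x : R => p x) _ _ Dp); field.
  - intros t Ht; destruct (Hdom t Ht) as [Hd H0].
    destruct (reduced_equations _ _ _ _ _ _ Hsol t Hd H0) as (D1 & D2 & D3 & DX & Dp).
    set (X := fun s => cot (q s)) in *; fold (X t) in D1, D2, D3, DX, Dp |- *.
    change (is_derive (fun s => m3 s * X s - m2 s / 2) t
      (- 2 * (p t - m1 t / 2) * X t * (m3 t * X t - m2 t / 2)
       - 3 / 2 * (p t - m1 t / 2) * m3 t + m1 t * m3 t / 4)).
    change (is_derive X t (- (1 + X t ^ 2) * (2 * p t - m1 t))) in DX.
    clearbody X; auto_derive; [repeat split; eexists; eassumption|].
    rewrite (is_derive_unique (fun x : R => m2 x) _ _ D2),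
      (is_derive_unique (fun x : R => m3 x) _ _ D3),
      (is_derive_unique (fun x : R => X x) _ _ DX); field.
  - intros t Ht; destruct (Hdom t Ht) as [Hd H0].
    destruct (reduced_equations _ _ _ _ _ _ Hsol t Hd H0) as (D1 & _).
    evar_last; [exact D1 | field].
  - intros t Ht; destruct (Hdom t Ht) as [Hd H0].
    destruct (reduced_equations _ _ _ _ _ _ Hsol t Hd H0) as (_ & D2 & _).
    evar_last; [exact D2 | field].
  - intros t Ht; destruct (Hdom t Ht) as [Hd H0].
    destruct (reduced_equations _ _ _ _ _ _ Hsol t Hd H0) as (_ & _ & D3 & _).
    evar_last; [exact D3 | field].
Qed.

(** The speed, which at time [0] involves unspecified two-sided derivatives, agrees
    at positive times with a function that is continuous on all of [0, tstar). *)
Lemma speed_extension : forall tstar m1 m2 m3 q p,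
  reduced_solution tstar m1 m2 m3 q p ->
  exists r : R -> R,
    (forall t, dom tstar t -> continuous r t) /\
    (forall t, dom tstar t -> 0 < t -> r t = speed m1 m2 m3 t).
Proof.
  intros tstar m1 m2 m3 q p Hsol.
  pose (X := fun s => cot (q s)).
  pose (r := fun s => sqrt
    ((X s * (- m2 s ^ 2 + m3 s ^ 2 + 2 * m2 s * m3 s * X s)) ^ 2
     + (m1 s * m2 s * X s - m3 s * p s - 2 * m1 s * m3 s * X s ^ 2) ^ 2
     + (m2 s * p s - m1 s * m3 s * X s) ^ 2)).
  exists (fun s => r (Rmax 0 s)); split.
  - intros t Ht; destruct (Hsol t Ht) as (Hq & D1 & D2 & D3 & Dq & Dp).
    apply (continuous_of_D_in _ _ _ _ Ht) in D1, D2, D3, Dq, Dp.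
    assert (DX : continuous (fun s => X (Rmax 0 s)) t).
    { apply (continuous_comp (fun s => q (Rmax 0 s)) cot); [exact Dq|].
      rewrite Rmax_right by apply Ht; apply (ex_derive_continuous cot).
      eexists; apply is_derive_cot, sin_neq_0, Hq. }
    unfold r; apply continuous_sqrt_comp; continuity_tac.
  - intros t Ht H0; rewrite Rmax_right by lra.
    destruct (reduced_equations _ _ _ _ _ _ Hsol t Ht H0) as (D1 & D2 & D3 & _).
    unfold r, speed; rewrite (is_derive_unique _ _ _ D1), (is_derive_unique _ _ _ D2),
      (is_derive_unique _ _ _ D3); reflexivity.
Qed.

Lemma collision_finite_length : forall tstar m1 m2 m3 q p,
  collision_trajectory tstar m1 m2 m3 q p -> finite_length tstar m1 m2 m3.
Proof.
  intros tstar m1 m2 m3 q p Hcol.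
  destruct (collision_is_near_collision _ _ _ _ _ _ Hcol) as (T & A & B & N).
  destruct (velocity_bound N) as (K & HK & HV).
  destruct Hcol as (Hpos & Hsol & _).
  destruct (speed_extension _ _ _ _ _ _ Hsol) as (r & Hr & Hrs).
  assert (Hdom : forall t, tail T tstar t -> dom tstar t /\ 0 < t).
  { intros t [H1 H2]; pose proof (nc_pos N).
    split; [split; [lra | exact H2] | lra]. }
  pose (F := fun t => RInt r 0 t).
  assert (HF : forall t, dom tstar t -> is_RInt r 0 t (F t)).
  { intros t Ht; apply (RInt_correct r), (ex_RInt_continuous r).
    intros z; rewrite Rmin_left, Rmax_right by apply Ht; intros Hz; apply Hr.
    split; [apply Hz | apply Rbar_le_lt_trans with (Finite t); [apply Hz | apply Ht]]. }
  destruct (converges_of_velocity_bound F r (2 * K) N) as [l Hl].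
  - lra.
  - intros t Ht; destruct (Hdom t Ht) as [Hd H0]; apply (is_derive_RInt r F 0 t).
    + apply (filter_imp (dom tstar)); [exact HF | apply dom_open; assumption].
    + apply Hr, Hd.
  - intros t Ht; destruct (Hdom t Ht) as [Hd H0]; rewrite (Hrs t Hd H0).
    destruct (HV t Ht) as (V1 & V2 & V3).
    set (c := K * _) in V1, V2, V3.
    assert (Hc : 0 <= c) by (pose proof (Rabs_pos (Derive m1 t)); lra).
    apply Rabs_le_between in V1, V2, V3.
    unfold speed; rewrite Rabs_pos_eq by apply sqrt_pos.
    rewrite Rmult_assoc; fold c.
    rewrite <- (sqrt_pow2 (2 * c)) by lra.
    apply sqrt_le_1_alt; nra.
  - exists l; intros P HP.
    apply Filter_prod with (Q := fun a => a = 0)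
      (R := fun t => dom tstar t /\ P (F t)).
    + reflexivity.
    + apply filter_and; [| apply Hl, HP].
      unfold before, within; apply filter_forall; auto.
    + intros a t -> [Ht HPt]; exists (F t); split; [|exact HPt]; simpl.
      apply (is_RInt_ext r); [| apply HF, Ht].
      intros s; rewrite Rmin_left, Rmax_right by apply Ht; intros Hs; apply Hrs; [|lra].
      split; [lra|].
      apply Rbar_le_lt_trans with (Finite t); [apply Rlt_le, Hs | apply Ht].
Qed.

Lemma collision_limits : forall tstar m1 m2 m3 q p,
  collision_trajectory tstar m1 m2 m3 q p ->
  exists m1s m2s : R,
    filterlim m1 (before tstar) (locally m1s) /\
    filterlim m2 (before tstar) (locally m2s) /\
    filterlim m3 (before tstar) (locally 0) /\
    filterlim p (before tstar) (Rbar_locally m_infty).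
Proof.
  intros tstar m1 m2 m3 q p Hcol.
  destruct (collision_is_near_collision _ _ _ _ _ _ Hcol) as (T & A & B & N).
  destruct (velocity_bound N) as (K & HK & HV).
  pose proof (cot_tends_to_infinity _ _ _ _ _ _ Hcol) as Hinf.
  assert (Htail : before tstar (tail T tstar)).
  { apply (before_tail tstar); [apply Hcol|].
    exists T; split; [apply N|]; split; [apply N | auto]. }
  pose proof (nc_A N) as HA.
  assert (Hlim : forall f : R -> R, (forall t, tail T tstar t -> ex_derive f t) ->
    (forall t, tail T tstar t -> Rabs (Derive f t) <= K * - (p t - m1 t / 2)) ->
    exists l, filterlim f (before tstar) (locally l)).
  { intros f Hf Hdf.
    apply (converges_of_velocity_bound f (Derive f) K N HK).
    - intros t Ht; apply Derive_correct, Hf, Ht.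
    - exact Hdf. }
  destruct (Hlim m1) as [m1s Hm1].
  { intros t Ht; eexists; exact (nc_dm1 N t Ht). }
  { intros t Ht; apply HV, Ht. }
  destruct (Hlim m2) as [m2s Hm2].
  { intros t Ht; eexists; exact (nc_dm2 N t Ht). }
  { intros t Ht; apply HV, Ht. }
  exists m1s, m2s; split; [exact Hm1|]; split; [exact Hm2|]; split.
  - apply filterlim_locally; intros eps; pose proof (cond_pos eps).
    pose (c := A ^ 2 + 3 * A + 4).
    generalize (filter_and _ _ Htail (Hinf (c / eps))); apply filter_imp.
    intros t [Ht HX].
    pose proof (infall_unit_speed N t Ht) as [HX1 _].
    pose proof (angular_momentum_bound N t Ht) as HXv.
    pose proof (nc_v N t Ht) as Hv.
    pose proof (nc_m2 N t Ht) as H2.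
    cbv beta in *; set (v := m3 t * cot (q t) - m2 t / 2) in *.
    apply (Rlt_div_l c (cot (q t)) eps) in HX; [|lra].
    assert (Hvb : - (A ^ 2 + 2 * A + 4) <= v <= A ^ 2 + 2 * A + 4).
    { clearbody v; clear - HX1 HXv; revert HXv; generalize (A ^ 2 + 2 * A + 4); intros; nra. }
    assert (Hc : - c < m3 t * cot (q t) < c) by (unfold c; lra).
    apply ball_R; clear - HX HX1 Hc H.
    generalize dependent (cot (q t)); intros; split; nra.
  - intros P [b Hb]; change (before tstar (fun t => P (p t))).
    pose (c := Rabs b + A).
    generalize (filter_and _ _ Htail (Hinf (4 * c ^ 2))); apply filter_imp.
    intros t [Ht HX]; apply Hb.
    pose proof (infall_negative N t Ht) as Hn.
    pose proof (infall_fast N t Ht) as Hf.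
    pose proof (nc_m1 N t Ht) as H1.
    cbv beta in *.
    pose proof (Rabs_pos b); pose proof (Rabs_maj2 b).
    assert (p t - m1 t / 2 < - c).
    { assert (Hc : 0 < c) by (unfold c; lra); clearbody c.
      clear - Hn Hf HX Hc; nra. }
    unfold c in *; lra.
Qed.

Lemma exists_times_to : forall tstar, Rbar_lt 0 tstar ->
  exists tk : nat -> R, (forall k, dom tstar (tk k)) /\
    (forall k, tk k <= tk (S k)) /\ is_lim_seq tk tstar.
Proof.
  intros [r| |] Hpos; simpl in Hpos; [| | contradiction].
  - assert (Hinv : forall k, 0 < / INR (S k) <= 1).
    { intros k; pose proof (lt_0_INR (S k) (Nat.lt_0_succ k)).
      split; [apply Rinv_0_lt_compat; assumption|].
      rewrite <- Rinv_1; apply Rinv_le_contravar; [lra|].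
      apply (le_INR 1), le_n_S, Nat.le_0_l. }
    exists (fun k => r - r * / INR (S k)); split; [|split].
    + intros k; specialize (Hinv k); split; [nra|].
      change (r - r * / INR (S k) < r); nra.
    + intros k.
      assert (/ INR (S (S k)) <= / INR (S k)).
      { apply Rinv_le_contravar; [apply lt_0_INR, Nat.lt_0_succ | apply le_INR; auto]. }
      nra.
    + evar_last.
      * apply is_lim_seq_minus'; [apply is_lim_seq_const|].
        apply (is_lim_seq_scal_l _ r 0).
        apply (is_lim_seq_incr_1 (fun k => / INR k)).
        apply (is_lim_seq_inv INR p_infty); [apply is_lim_seq_INR | discriminate].
      * simpl; f_equal; ring.
  - exists INR; split; [|split].
    + intros k; split; [apply pos_INR | exact I].
    + intros k; apply le_INR; auto.
    + apply is_lim_seq_INR.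
Qed.

Theorem theorem3p17 :
  forall (tstar : Rbar) (m1 m2 m3 q p : R -> R),
    collision_trajectory tstar m1 m2 m3 q p ->
    (forall t : R, dom tstar t ->
       casimir (m1 t) (m2 t) (m3 t) = casimir (m1 0) (m2 0) (m3 0)) /\
    finite_length tstar m1 m2 m3 /\
    exists m1s m2s : R,
      forall x : R * R * R * R * Rbar,
        omega_limit tstar m1 m2 m3 q p x <-> x = (m1s, m2s, 0, 0, m_infty).
Proof.
  intros tstar m1 m2 m3 q p Hcol.
  split; [apply (casimir_constant _ _ _ _ q p), Hcol|].
  split; [apply (collision_finite_length _ _ _ _ q p), Hcol|].
  destruct (collision_limits _ _ _ _ _ _ Hcol) as (m1s & m2s & L1 & L2 & L3 & Lp).
  exists m1s, m2s.
  assert (Htk : forall (tk : nat -> R) (f : R -> R) G,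
    (forall k, dom tstar (tk k)) -> is_lim_seq tk tstar ->
    filterlim f (before tstar) G -> filterlim (fun k => f (tk k)) eventually G).
  { intros tk f G Hd Hl; apply filterlim_comp; intros P HP.
    destruct (Hl _ HP) as [n Hn]; exists n; intros k Hk; apply (Hn k Hk), Hd. }
  intros [[[[x1 x2] x3] xq] xp]; split.
  - intros (tk & Hd & _ & Hl & K1 & K2 & K3 & Kq & Kp).
    apply is_lim_seq_unique in K1, K2, K3, Kq, Kp.
    pose proof (is_lim_seq_unique _ m1s (Htk tk m1 _ Hd Hl L1)).
    pose proof (is_lim_seq_unique _ m2s (Htk tk m2 _ Hd Hl L2)).
    pose proof (is_lim_seq_unique _ 0 (Htk tk m3 _ Hd Hl L3)).
    pose proof (is_lim_seq_unique _ 0 (Htk tk q _ Hd Hl (proj2 (proj2 Hcol)))).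
    pose proof (is_lim_seq_unique _ m_infty (Htk tk p _ Hd Hl Lp)).
    repeat f_equal; congruence.
  - intros E; injection E as -> -> -> -> ->.
    destruct (exists_times_to tstar (proj1 Hcol)) as (tk & Hd & Hmono & Hl).
    exists tk; repeat split; try assumption; try (apply Hd);
      apply (fun f G => Htk tk f G Hd Hl); try assumption; apply Hcol.
Qed.
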